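(* Let $w_1,w_2$ be self-coherent weight functions, let $n\ge1$, and let $Q_k^n$, $S_k^n$ be as in the context. For $0\le k\le n$ there exist real numbers $a_{i,k}$ and $b_{i,k}$ such that $$Q_k^n(x,y)\doteq S_k^n(x,y)+\sum_{i=0}^{n-1}a_{i,k}S_i^{n-1}(x,y)+\sum_{i=0}^{n-2}b_{i,k}S_i^{n-2}(x,y).$$ Moreover, for $k=0$ and $k=n$, $$S_0^n(x,y)\doteq Q_0^n(x,y),\qquad S_n^n(x,y)\doteq Q_n^n(x,y).$$ In vector notation, with $\mathbb{Q}_n=(Q_0^n,\dots,Q_n^n)^{\mathsf T}$ and $\mathbb{S}_n=(S_0^n,\dots,S_n^n)^{\mathsf T}$, $$\mathbb{Q}_n\doteq \mathbb{S}_n+\mathbf{A}_{n-1}\mathbb{S}_{n-1}+\mathbf{B}_{n-2}\mathbb{S}_{n-2},$$ where $\mathbf{A}_{n-1}$ and $\mathbf{B}_{n-2}$ are real matrices of sizes $(n+1)\times n$ and $(n+1)\times(n-1)$ whose first and last rows are zero, i.e. they consist of a zero row, followed by matrices $\widetilde{\mathbf A}_{n-1}$ of size $(n-1)\times n$ and $\widetilde{\mathbf B}_{n-2}$ of size $(n-1)\times(n-1)$, respectively, followed by a zero row.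
   Context: For $i=1,2$ let $w_i$ be a nonnegative weight function on an interval $[a_i,b_i]$ (possibly infinite), with all moments finite and $\int p^2w_i>0$ for every nonzero polynomial $p$; let $p_m(w_i;\cdot)$ denote its monic orthogonal polynomial of degree $m$, with $p_{-1}=0$. A weight $w$ is called self-coherent if there are real constants $a_n=a_n(w)$, $b_n=b_n(w)$ with $$p_n(w;x)=\frac{p_{n+1}'(w;x)}{n+1}+a_np_n'(w;x)+b_np_{n-1}'(w;x),\qquad n\ge1$$ (and $a_0$ is any fixed constant). For a self-coherent $w$ define $q_0(w;x)=1$ and $$q_n(w;x)=p_n(w;x)+n a_{n-1}p_{n-1}(w;x)+n b_{n-1}p_{n-2}(w;x),\quad n\ge1,$$ where the last term is zero if $n=1$; then $q_n'(w;x)=np_{n-1}(w;x)$. Define $Q_k^n(x,y)=q_{n-k}(w_1;x)q_k(w_2;y)$, $0\le k\le n$. Let $W(x,y)=w_1(x)w_2(y)$ on $\Omega=[a_1,b_1]\times[a_2,b_2]$, $c=1/\iint_\Omega W$, and $\langle f,g\rangle_\nabla=c\iint_\Omega\nabla f\cdot\nabla g\,W\,dx\,dy$. Let $\Pi_n^2$ be the space of real polynomials in $x,y$ of total degree at most $n$. For $n\ge1$ and $0\le k\le n$, $S_k^n$ is a monic orthogonal polynomial for $\langle\cdot,\cdot\rangle_\nabla$: $S_k^n-x^{n-k}y^k\in\Pi_{n-1}^2$ and $\langle S_k^n,P\rangle_\nabla=0$ for all $P\in\Pi_{n-1}^2$ (it is determined up to an additive constant; fix any choice). Take $S_0^0=1$,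 and treat terms of negative degree as absent. The notation $f\doteq g$ means that $f-g$ is a constant (for vectors, componentwise). *)

(* Defs.v *)
From HB Require Import structures.
From mathcomp Require Import all_boot all_order all_algebra.
From mathcomp Require Import all_classical all_reals all_analysis.

Set Implicit Arguments.
Unset Strict Implicit.
Unset Printing Implicit Defensive.

Import Order.TTheory GRing.Theory Num.Theory.
Import numFieldNormedType.Exports.

Local Open Scope classical_set_scope.
Local Open Scope ring_scope.

(* The closed interval [l, r] of R whose endpoints may be infinite. *)
Definition cint (R : realType) (l r : \bar R) : set (measurableTypeR R) :=
  [set x | (l <= x%:E)%E /\ (x%:E <= r)%E].

Definition wint (R : realType) (l r : \bar R) (w : R -> R) (p : {poly R}) : R :=
  \int[lebesgue_measure]_(x in cint l r) (p.[x] * w x).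

(* Integrability of the moments includes the measurability of w on [l, r]. *)
Definition weight (R : realType) (l r : \bar R) (w : R -> R) : Prop :=
  [/\ forall x : R, cint l r x -> 0 <= w x,
      forall k : nat, lebesgue_measure.-integrable (cint l r)
        (fun x : measurableTypeR R => ((x : R) ^+ k * w x)%:E)
    & forall p : {poly R}, p != 0 -> 0 < wint l r w (p ^+ 2)].

Definition monic_ops (R : realType) (l r : \bar R) (w : R -> R)
    (p : nat -> {poly R}) : Prop :=
  forall m : nat,
    [/\ p m \is monic, size (p m) = m.+1
      & forall q : {poly R}, (size q <= m)%N -> wint l r w (p m * q) = 0].

(* p_{m-1}, with the convention p_{-1} = 0 *)
Definition prevp (R : realType) (p : nat -> {poly R}) (m : nat) : {poly R} :=
  if m is j.+1 then p j else 0.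

(* The weight with monic orthogonal polynomials p is self-coherent when such
   a and b exist; a 0, b 0 and b 1 are unconstrained. *)
Definition self_coherent_coeffs (R : realType) (p : nat -> {poly R})
    (a b : nat -> R) : Prop :=
  forall n : nat, (1 <= n)%N ->
    p n = n.+1%:R^-1 *: (p n.+1)^`() + a n *: (p n)^`()
          + b n *: (prevp p n)^`().

Definition sobq (R : realType) (p : nat -> {poly R}) (a b : nat -> R)
    (n : nat) : {poly R} :=
  if n is m.+1
  then p n + (n%:R * a m) *: p m + (n%:R * b m) *: prevp p m
  else 1.

(* Polynomials in (x, y) are elements of {poly {poly R}}: x is the outer
   variable 'X and y is the inner variable 'Y = 'X%:P. *)
Definition sobQ (R : realType) (q1 q2 : nat -> {poly R}) (n k : nat) :
  {poly {poly R}} := (q1 (n - k)%N)^:P * (q2 k)%:P.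

Definition cst2 (R : realType) (c : R) : {poly {poly R}} := c%:P%:P.

Definition Pi2 (R : realType) (n : nat) (f : {poly {poly R}}) : Prop :=
  forall i j : nat, (n < i + j)%N -> f`_i`_j = 0.

Definition dX (R : realType) (f : {poly {poly R}}) : {poly {poly R}} := f^`().

Definition dY (R : realType) (f : {poly {poly R}}) : {poly {poly R}} :=
  map_poly (@deriv R) f.

Definition wint2 (R : realType) (l1 r1 l2 r2 : \bar R) (w1 w2 : R -> R)
    (f : {poly {poly R}}) : R :=
  \int[(lebesgue_measure \x lebesgue_measure)%E]_(z in cint l1 r1 `*` cint l2 r2)
    (f.[z.1, z.2] * (w1 z.1 * w2 z.2)).

Definition grad_ip (R : realType) (l1 r1 l2 r2 : \bar R) (w1 w2 : R -> R)
    (f g : {poly {poly R}}) : R :=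
  (wint2 l1 r1 l2 r2 w1 w2 1)^-1
  * wint2 l1 r1 l2 r2 w1 w2 (dX f * dX g + dY f * dY g).

Definition sobolev_monic_ops (R : realType) (l1 r1 l2 r2 : \bar R)
    (w1 w2 : R -> R) (Sb : nat -> nat -> {poly {poly R}}) : Prop :=
  Sb 0%N 0%N = 1 /\
  forall n k : nat, (1 <= n)%N -> (k <= n)%N ->
    Pi2 n.-1 (Sb n k - 'X ^+ (n - k) * 'Y ^+ k) /\
    (forall P : {poly {poly R}}, Pi2 n.-1 P ->
       grad_ip l1 r1 l2 r2 w1 w2 (Sb n k) P = 0).

Definition doteq (R : realType) (f g : {poly {poly R}}) : Prop :=
  exists c : R, f - g = cst2 c.

Definition doteqv (R : realType) (m : nat) (u v : 'cV[{poly {poly R}}]_m) :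
  Prop := forall k : 'I_m, doteq (u k 0) (v k 0).

(* Main.v *)
Require Import Defs.
From HB Require Import structures.
From mathcomp Require Import all_boot all_order all_algebra.
From mathcomp Require Import all_classical all_reals all_analysis.
From mathcomp Require Import measurable_realfun.
From mathcomp Require Import ring zify.

Set Implicit Arguments.
Unset Strict Implicit.
Unset Printing Implicit Defensive.

Import Order.TTheory GRing.Theory Num.Theory.
Import numFieldNormedType.Exports.

Local Open Scope classical_set_scope.
Local Open Scope ring_scope.

(* Since q_n' = n p_{n-1}, each partial derivative of Q_k^n is a product of an
   orthogonal polynomial in one variable and a polynomial q in the other;
   q_m is orthogonal to polynomials of degree at most m - 3, so that Q_k^n is
   Sobolev-orthogonal to polynomials of degree at most n - 3 (n - 1 when k = 0
   or k = n, because one of the two partial derivatives vanishes).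
   Subtracting S_k^n, then the combinations of the S_i^{n-1} and S_i^{n-2} that
   cancel the leading forms, leaves a polynomial of degree at most n - 3
   orthogonal to itself, which is a constant because integration against the
   product weight is positive definite on bivariate polynomials. *)

(** * Fubini for products of functions of one variable each *)

Section integral_of_products.
Context d1 d2 (T1 : measurableType d1) (T2 : measurableType d2) (R : realType).
Variables (mu1 : {sigma_finite_measure set T1 -> \bar R})
          (mu2 : {sigma_finite_measure set T2 -> \bar R}).
Variables (D1 : set T1) (D2 : set T2) (f : T1 -> R) (g : T2 -> R).
Hypotheses (mD1 : measurable D1) (mD2 : measurable D2).
Hypotheses (intf : mu1.-integrable D1 (EFin \o f))
           (intg : mu2.-integrable D2 (EFin \o g)).

Let fg (z : T1 * T2) : R := f z.1 * g z.2.

(** Extension by zero commutes with the product, which moves everything to the whole product space,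
    where Tonelli and Fubini apply. *)
Let fg_restrict (z : T1 * T2) :
  (fg \_ (D1 `*` D2)) z = (f \_ D1) z.1 * (g \_ D2) z.2.
Proof.
rewrite !patchE in_setX.
by case: (z.1 \in D1); case: (z.2 \in D2) => //=; rewrite ?mul0r ?mulr0.
Qed.

Let intfT : mu1.-integrable setT (EFin \o (f \_ D1)).
Proof. by rewrite -restrict_EFin; exact: (integrable_mkcond _ mD1).1 intf. Qed.

Let intgT : mu2.-integrable setT (EFin \o (g \_ D2)).
Proof. by rewrite -restrict_EFin; exact: (integrable_mkcond _ mD2).1 intg. Qed.

Let mf : measurable_fun setT (f \_ D1).
Proof. by apply/measurable_EFinP; exact: measurable_int intfT. Qed.

Let mg : measurable_fun setT (g \_ D2).
Proof. by apply/measurable_EFinP; exact: measurable_int intgT. Qed.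

(** By Tonelli it is enough that the iterated integral of |f(x)| |g(y)| is finite; it factors into
    two integrals that are finite by integrability of [f] and [g]. *)
Let intfgT :
  (mu1 \x mu2)%E.-integrable setT (EFin \o (fg \_ (D1 `*` D2))).
Proof.
have -> : EFin \o (fg \_ (D1 `*` D2)) =
    EFin \o (fun z => (f \_ D1) z.1 * (g \_ D2) z.2).
  by apply/funext => z /=; rewrite fg_restrict.
apply/integrable12ltyP.
  by apply/measurable_EFinP/measurable_funM; exact: measurableT_comp.
under eq_integral => x _.
  under eq_integral do rewrite /= normrM EFinM.
  rewrite ge0_integralZl_EFin//; last first.
    by apply/measurable_EFinP/measurableT_comp.
  over.
rewrite /=.
have /integrableP[_ goo] := intgT.
have /integrableP[_ foo] := intfT.
have gfin : (\int[mu2]_x `|(g \_ D2) x|%:E)%E \is a fin_num.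
  by rewrite ge0_fin_numE// integral_ge0.
rewrite -(fineK gfin).
under eq_integral do rewrite muleC.
rewrite ge0_integralZl_EFin//.
- by rewrite -ge0_fin_numE// ?mule_ge0 ?integral_ge0// ?fin_numM//
     ?ge0_fin_numE ?integral_ge0// lee_fin fine_ge0// integral_ge0.
- by apply/measurable_EFinP/measurableT_comp.
- by rewrite fine_ge0// integral_ge0.
Qed.

Lemma integrable_prod_measM :
  (mu1 \x mu2)%E.-integrable (D1 `*` D2) (EFin \o fg).
Proof.
apply/integrable_mkcond; first exact: measurableX.
by rewrite restrict_EFin.
Qed.

Lemma Rintegral_prod_measM :
  \int[(mu1 \x mu2)%E]_(z in D1 `*` D2) fg z =
  \int[mu1]_(x in D1) f x * \int[mu2]_(y in D2) g y.
Proof.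
have intE : (\int[mu2]_y ((g \_ D2) y)%:E)%E = (\int[mu2]_(y in D2) g y)%:E.
  by rewrite Rintegral_mkcond fineK//; exact: integrable_fin_num.
rewrite Rintegral_mkcond /Rintegral -integral12_prod_meas1//.
transitivity
    (fine (\int[mu1]_x (((f \_ D1) x)%:E * (\int[mu2]_(y in D2) g y)%:E))%E).
  congr fine; apply: eq_integral => x _.
  rewrite /fubini_F -intE -integralZl//.
  by apply: eq_integral => y _; rewrite /= fg_restrict EFinM.
rewrite integralZr// fineM//; last exact: integrable_fin_num.
by congr (fine _ * _); rewrite [RHS]integral_mkcond restrict_EFin.
Qed.

End integral_of_products.

(** * Weighted integrals as linear functionals on polynomials *)

Section weighted_integrals.
Variable R : realType.
Implicit Types (l r : \bar R) (w : R -> R).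

Lemma measurable_cint l r : measurable (cint l r).
Proof.
have -> : cint l r = setT `&` EFin @^-1` [set` `[l, r]].
  rewrite setTI; apply/seteqP; split=> x; rewrite /cint /= in_itv /=.
    by move=> [-> ->].
  by move=> /andP[].
by apply: EFin_measurable => //; exact: emeasurable_itv.
Qed.

Lemma weight_integrable l r w (p : {poly R}) : weight l r w ->
  lebesgue_measure.-integrable (cint l r)
    (EFin \o (fun x : measurableTypeR R => p.[x] * w x)).
Proof.
move=> [_ mom _].
have -> : EFin \o (fun x : measurableTypeR R => p.[x] * w x) =
   (fun x : measurableTypeR R =>
      \sum_(i < size p) (p`_i)%:E * ((x : R) ^+ i * w x)%:E)%E.
  apply/funext => x /=; rewrite horner_coef mulr_suml -sumEFin.
  by apply: eq_bigr => i _; rewrite -EFinM mulrA.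
have mD := measurable_cint l r.
by apply: integrable_sum => // i _; exact: integrableZl.
Qed.

Lemma wint_is_linear l r w : weight l r w ->
  linear (wint l r w : {poly R} -> R^o).
Proof.
move=> hw a p q; have mD := measurable_cint l r.
have intp := weight_integrable p hw; have intq := weight_integrable q hw.
rewrite /wint /GRing.scale /= -RintegralZl// -RintegralD//.
  by apply: eq_Rintegral => x _; rewrite hornerD hornerZ mulrDl mulrA.
by apply: eq_integrable (integrableZl mD a intp) => // x _.
Qed.

(** Expanding [f] in powers of x gives a finite sum of products of a function of x and a function of
    y, and Fubini applies to each term. From here on the double integral is the composition of two
    linear functionals, and the argument is purely algebraic. *)
Lemma wint2_iterated l1 r1 l2 r2 w1 w2 (f : {poly {poly R}}) :
  weight l1 r1 w1 -> weight l2 r2 w2 ->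
  wint2 l1 r1 l2 r2 w1 w2 f = wint l1 r1 w1 (map_poly (wint l2 r2 w2) f).
Proof.
move=> hw1 hw2.
pose L1 : {linear {poly R} -> R^o} := HB.pack (wint l1 r1 w1 : {poly R} -> R^o)
  (GRing.isLinear.Build _ _ _ _ _ (wint_is_linear hw1)).
pose F (i : nat) (z : measurableTypeR R * measurableTypeR R) : R :=
  ('X^i.[z.1] * w1 z.1) * ((f`_i).[z.2] * w2 z.2).
have mD1 := measurable_cint l1 r1; have mD2 := measurable_cint l2 r2.
have intX i := weight_integrable 'X^i hw1.
have intf i := weight_integrable f`_i hw2.
have FE z : (f.[z.1, z.2] * (w1 z.1 * w2 z.2)) = \sum_(i < size f) F i z.
  rewrite (horner_coef f) horner_sum mulr_suml; apply: eq_bigr => i _.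
  by rewrite /F !hornerE /=; ring.
have -> : wint2 l1 r1 l2 r2 w1 w2 f =
    \sum_(i < size f) wint l1 r1 w1 'X^i * wint l2 r2 w2 f`_i.
  have -> : wint2 l1 r1 l2 r2 w1 w2 f =
      \sum_(i < size f) \int[(lebesgue_measure \x lebesgue_measure)%E]_(z in
        cint l1 r1 `*` cint l2 r2) F i z.
    rewrite /wint2 /Rintegral.
    under eq_integral do rewrite FE -sumEFin.
    have intF (i : 'I_(size f)) :
        (lebesgue_measure \x lebesgue_measure)%E.-integrable
        (cint l1 r1 `*` cint l2 r2) (fun z => (F i z)%:E).
      exact: integrable_prod_measM mD1 mD2 (intX i) (intf i).
    have mD := measurableX mD1 mD2.
    rewrite (integral_sum mD intF) -sum_fine// => i _.
    exact: integrable_fin_num.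
  by apply: eq_bigr => i _;
    exact: (Rintegral_prod_measM mD1 mD2 (intX i) (intf i)).
have -> : map_poly (wint l2 r2 w2) f =
    \sum_(i < size f) (wint l2 r2 w2 f`_i) *: 'X^i.
  rewrite -(poly_def _ (fun i => wint l2 r2 w2 f`_i)); exact: eq_poly.
rewrite -[RHS]/(L1 (\sum_(i < size f) wint l2 r2 w2 f`_i *: 'X^i)) linear_sum.
by apply: eq_bigr => i _; rewrite linearZ mulrC.
Qed.

End weighted_integrals.

(** * Total degree, partial derivatives and leading forms in two variables *)

Section bivariate_polynomials.
Variable R : realType.
Implicit Types (f g : {poly {poly R}}) (p q : {poly R}) (c : R).

Lemma Pi2D m f g : Pi2 m f -> Pi2 m g -> Pi2 m (f + g).
Proof. by move=> hf hg i j hij; rewrite !coefD hf// hg// addr0. Qed.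

Lemma Pi2N m f : Pi2 m f -> Pi2 m (- f).
Proof. by move=> hf i j hij; rewrite !coefN hf// oppr0. Qed.

Lemma Pi2_cstM m c f : Pi2 m f -> Pi2 m (cst2 c * f).
Proof. by move=> hf i j hij; rewrite !coefCM hf// mulr0. Qed.

Lemma Pi2_sum m (I : Type) (s : seq I) (F : I -> {poly {poly R}}) :
  (forall i, Pi2 m (F i)) -> Pi2 m (\sum_(i <- s) F i).
Proof.
move=> hF; apply: (big_ind (Pi2 m)) => //; last exact: Pi2D.
by move=> i j _; rewrite !coef0.
Qed.

Lemma Pi2W m k f : (m <= k)%N -> Pi2 m f -> Pi2 k f.
Proof. by move=> mk hf i j hij; apply: hf; exact: leq_ltn_trans hij. Qed.

Lemma Pi2_0_cst f : Pi2 0 f -> exists c, f = cst2 c.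
Proof.
move=> hf; exists f`_0`_0; apply/polyP => i; apply/polyP => j.
rewrite coefC; case: i => [|i] /=; last by rewrite coef0 hf.
by rewrite coefC; case: j => [|j] //=; rewrite hf.
Qed.

Lemma Pi2_dX m f : Pi2 m.+1 f -> Pi2 m (dX f).
Proof. by move=> hf i j hij; rewrite coef_deriv coefMn hf ?mul0rn. Qed.

Lemma coef_dY f i : (dY f)`_i = (f`_i)^`().
Proof. by rewrite coef_map_id0 ?deriv0. Qed.

Lemma Pi2_dY m f : Pi2 m.+1 f -> Pi2 m (dY f).
Proof.
by move=> hf i j hij; rewrite coef_dY coef_deriv hf ?mul0rn// addnS.
Qed.

Lemma dXD f g : dX (f + g) = dX f + dX g. Proof. exact: derivD. Qed.

Lemma dYD f g : dY (f + g) = dY f + dY g.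
Proof. by apply/polyP => i; rewrite coefD !coef_dY coefD derivD. Qed.

Lemma dX_cstM c f : dX (cst2 c * f) = cst2 c * dX f.
Proof. by rewrite /dX derivM derivC mul0r add0r. Qed.

Lemma dY_cstM c f : dY (cst2 c * f) = cst2 c * dY f.
Proof.
by apply/polyP => i; rewrite coefCM !coef_dY coefCM derivM derivC mul0r add0r.
Qed.

Lemma dX_cst2 c : dX (cst2 c) = 0. Proof. by rewrite /dX derivC. Qed.

Lemma dY_cst2 c : dY (cst2 c) = 0.
Proof.
apply/polyP => i; rewrite coef_dY coef0 coefC.
by case: (i == 0)%N; rewrite ?derivC ?deriv0.
Qed.

(** In characteristic 0, [dX f = 0] kills the coefficients with a positive power of x, and
    [dY f = 0] those of the pure powers of y. *)
Lemma grad0_cst f : dX f = 0 -> dY f = 0 -> exists c, f = cst2 c.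
Proof.
move=> fx fy; apply: Pi2_0_cst => -[|i] [|j] // _.
  have /(congr1 (fun g => g`_0`_j)) := fy.
  rewrite coef_dY coef_deriv !coef0 => /eqP.
  by rewrite mulrn_eq0 /= => /eqP.
all: have /(congr1 (fun g => g`_i)) := fx.
all: rewrite coef_deriv coef0 => /eqP; rewrite -scaler_nat scaler_eq0.
all: by rewrite pnatr_eq0 /= => /eqP ->; rewrite coef0.
Qed.

Lemma dX_prod p q : dX (p^:P * q%:P) = (p^`())^:P * q%:P.
Proof. by rewrite /dX derivM derivC mulr0 addr0 deriv_map. Qed.

Lemma dY_prod p q : dY (p^:P * q%:P) = p^:P * (q^`())%:P.
Proof.
apply/polyP => i; rewrite coef_dY !coefMC !coef_map /=.
by rewrite derivM derivC mul0r add0r.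
Qed.

Lemma coef_XY i j a b : ('X ^+ i * 'Y ^+ j : {poly {poly R}})`_a`_b =
  ((a == i) && (b == j))%:R.
Proof.
rewrite -polyC_exp coefMC coefXn.
by case: (a == i); rewrite ?mul1r ?mul0r ?coef0 // coefXn.
Qed.

(** The form of degree m+1 of [f] is a combination of monomials x^(m+1-i) y^i, and each [S i]
    differs from its monomial only in degree at most m. *)
Lemma Pi2_reduce m f (S : nat -> {poly {poly R}}) : Pi2 m.+1 f ->
  (forall i, (i <= m.+1)%N -> Pi2 m (S i - 'X ^+ (m.+1 - i) * 'Y ^+ i)) ->
  Pi2 m (f - \sum_(i < m.+2) cst2 f`_(m.+1 - i)`_i * S i).
Proof.
move=> hf hS.
pose M i : {poly {poly R}} := 'X ^+ (m.+1 - i) * 'Y ^+ i.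
have -> : f - \sum_(i < m.+2) cst2 f`_(m.+1 - i)`_i * S i =
    (f - \sum_(i < m.+2) cst2 f`_(m.+1 - i)`_i * M i)
    - \sum_(i < m.+2) cst2 f`_(m.+1 - i)`_i * (S i - M i).
  under [X in _ = _ - X]eq_bigr do rewrite mulrBr.
  by rewrite sumrB opprB addrA subrK.
apply: Pi2D; last first.
  by apply/Pi2N/Pi2_sum => i; apply/Pi2_cstM/hS; rewrite -ltnS.
move=> a b hab; rewrite !coefB !coef_sum.
under eq_bigr do rewrite !coefCM coef_XY.
(* Above degree m+1 all coefficients are zero; in degree m+1 only the summand with index [b]
   contributes, and it cancels the coefficient of [f]. *)
have [ab|ab] := ltnP m.+1 (a + b)%N.
  rewrite hf// big1 ?subrr// => i _.
  have im := ltn_ord i.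
  have -> : (a == m.+1 - i)%N && (b == i) = false by lia.
  by rewrite mulr0.
have bm : (b < m.+2)%N by lia.
rewrite (bigD1 (Ordinal bm))//= big1 ?addr0 => [|i].
  have -> : a = (m.+1 - b)%N by lia.
  by rewrite !eqxx mulr1 subrr.
rewrite -val_eqE /= => ib.
by rewrite [b == i]eq_sym (negbTE ib) andbF mulr0.
Qed.

End bivariate_polynomials.

(** * The product of two linear functionals *)

Section product_functional.
Variables (R : realType) (L1 L2 : {linear {poly R} -> R^o}).
Implicit Types (f g : {poly {poly R}}) (p q : {poly R}) (c : R).

(* L1 acts in the outer variable x and L2 in the inner variable y. *)
Definition prodf f : R := L1 (map_poly L2 f).

Lemma prodfD f g : prodf (f + g) = prodf f + prodf g.
Proof. by rewrite /prodf !raddfD. Qed.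

Lemma prodf_cstM c f : prodf (cst2 c * f) = c * prodf f.
Proof.
rewrite /prodf; have -> : map_poly L2 (cst2 c * f) = c *: map_poly L2 f.
  apply/polyP => i.
  by rewrite coefZ !coef_map /= coefCM mul_polyC linearZ.
by rewrite linearZ.
Qed.

Lemma map_poly_mul_lift p g : map_poly L2 (p^:P * g) = p * map_poly L2 g.
Proof.
apply/polyP => i; rewrite coef_map /= !coefM raddf_sum.
by apply: eq_bigr => j _; rewrite !coef_map /= mul_polyC linearZ.
Qed.

(** A monomial x^i y^j of [g] has i + j < t + s, hence i < t or j < s. Applying [L2] to [q] times
    the coefficient of x^i gives 0 when i >= t; what is left has size at most t in x and is killed
    by [L1]. *)
Lemma prodf_orth p q (s t m : nat) g :
  (forall u : {poly R}, (size u <= t)%N -> L1 (p * u) = 0) ->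
  (forall u : {poly R}, (size u <= s)%N -> L2 (q * u) = 0) ->
  Pi2 m g -> (m < t + s)%N -> prodf (p^:P * q%:P * g) = 0.
Proof.
move=> hp hq hg mts; rewrite /prodf -mulrA map_poly_mul_lift; apply: hp.
apply/leq_sizeP => i ti; rewrite coef_map /= coefCM; apply: hq.
by apply/leq_sizeP => j sj; apply: hg; lia.
Qed.

(** * Positive definiteness of the product functional *)

Section positivity.
Variable P : nat -> {poly R}.
Hypotheses (Pmonic : forall m, P m \is monic)
           (sizeP : forall m, size (P m) = m.+1).
Hypothesis Porth : forall m (q : {poly R}), (size q <= m)%N -> L1 (P m * q) = 0.
Hypothesis L1_gt0 : forall p : {poly R}, p != 0 -> 0 < L1 (p ^+ 2).
Hypothesis L2_gt0 : forall p : {poly R}, p != 0 -> 0 < L2 (p ^+ 2).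

(* The top term [P N (x) * h (y)] of [g] is orthogonal to the
   remainder, so that the square of [g] splits into a sum of squares. *)
Lemma prodf_sqr_gt0 g : g != 0 -> 0 < prodf (g ^+ 2).
Proof.
(* Induction on a bound for the size of [g] as a polynomial in x. *)
have [N] := ubnP (size g); elim: N g => // N IH g sg g0.
have [sgN|sgN] := ltnP (size g) N; first exact: IH.
have {}sg : (size g <= N)%N by [].
have {sgN}sgN : size g = N by apply/eqP; rewrite eqn_leq sg.
case: N => [|N] in IH sg sgN *.
  by move: g0; rewrite -size_poly_eq0 sgN.
pose h := g`_N; pose r := g - (P N)^:P * h%:P.
have h0 : h != 0 by rewrite /h -[N]/(N.+1.-1) -sgN lead_coef_eq0.
have rN : (size r <= N)%N.
  apply/leq_sizeP => j; rewrite leq_eqVlt => /orP[/eqP<-|Nj].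
    have := monicP (Pmonic N); rewrite lead_coefE sizeP /= => PN.
    by rewrite coefB coefMC coef_map /= PN mul1r subrr.
  rewrite coefB coefMC coef_map /= (leq_sizeP _ _ sg)//.
  by rewrite (leq_sizeP (P N) N.+1 _)// ?sizeP// mul0r subr0.
have -> : g ^+ 2 = (P N ^+ 2)^:P * (h ^+ 2)%:P
    + ((P N)^:P * (h%:P * r) + (P N)^:P * (h%:P * r)) + r ^+ 2.
  by rewrite /r !rmorphXn /=; ring.
(* Once [L2] has acted in y, the factor coming from [r] has degree less than N in x. *)
have cross : prodf ((P N)^:P * (h%:P * r)) = 0.
  rewrite /prodf map_poly_mul_lift; apply: Porth.
  apply/leq_sizeP => j Nj; rewrite coef_map /= coefCM.
  by rewrite (leq_sizeP _ _ rN)// mulr0 linear0.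
rewrite 3!prodfD cross !addr0 {1}/prodf map_poly_mul_lift map_polyC /=.
have -> : P N ^+ 2 * (L2 (h ^+ 2))%:P = L2 (h ^+ 2) *: P N ^+ 2.
  by rewrite mulrC mul_polyC.
rewrite linearZ ltr_wpDr//.
  have [->|r0] := eqVneq r 0; first
    by rewrite expr0n /= /prodf map_poly0 linear0.
  by apply/ltW/IH.
by rewrite mulr_gt0// ?L1_gt0 ?L2_gt0// monic_neq0.
Qed.

End positivity.
End product_functional.

(** * The univariate polynomials q_n: degree, derivative, orthogonality *)

Section sobolev_polynomials.
Variables (R : realType) (L : {linear {poly R} -> R^o}).
Variables (p : nat -> {poly R}) (a b : nat -> R).
Hypotheses (pmonic : forall m, p m \is monic)
           (sizep : forall m, size (p m) = m.+1).
Hypothesis porth : forall m (q : {poly R}), (size q <= m)%N -> L (p m * q) = 0.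
Hypothesis coh : self_coherent_coeffs p a b.

Lemma monic_ops_0 : p 0%N = 1.
Proof.
have h := sizep 0%N; have := monicP (pmonic 0%N); rewrite lead_coefE h /= => p0.
by rewrite [LHS]size1_polyC ?h// p0.
Qed.

Lemma size_prevp n : (size (prevp p n) <= n)%N.
Proof. by case: n => [|n] /=; rewrite ?size_poly0 ?sizep. Qed.

Lemma size_sobq n : size (sobq p a b n) = n.+1.
Proof.
case: n => [|n]; first by rewrite size_poly1.
rewrite /sobq -addrA size_polyDl sizep// ltnS.
rewrite (leq_trans (size_polyD _ _))// geq_max.
rewrite !(leq_trans (size_scale_leq _ _))// ?sizep//.
exact: leq_trans (size_prevp n) _.
Qed.

Lemma sobq_lead n : (sobq p a b n)`_n = 1.
Proof.
case: n => [|n]; first by rewrite coef1.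
have := monicP (pmonic n.+1); rewrite lead_coefE sizep /= => pn.
rewrite !coefD !coefZ pn.
rewrite [(p n)`_n.+1]nth_default ?sizep//.
by rewrite nth_default ?(leq_trans (size_prevp n))// !mulr0 !addr0.
Qed.

(** For n >= 1 this is the coherence relation at n multiplied by n+1. That relation says nothing at
    n = 0, where q_1 is [p 1] plus a constant and has derivative 1. *)
Lemma deriv_sobqS n : (sobq p a b n.+1)^`() = n.+1%:R *: p n.
Proof.
rewrite /sobq !derivD !derivZ; case: n => [|n].
  rewrite /= monic_ops_0 -polyC1 derivC deriv0 !scaler0 !addr0 scale1r.
  have p1 : p 1%N = 'X + ((p 1%N)`_0)%:P.
    apply/polyP => i; rewrite coefD coefX coefC.
    have := monicP (pmonic 1%N); rewrite lead_coefE sizep /= => p1.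
    case: i => [|[|i]] /=; rewrite ?add0r ?addr0//.
    by rewrite nth_default ?sizep.
  by rewrite p1 derivD derivX derivC addr0.
rewrite [in RHS](coh (ltn0Sn n)) !scalerDr !scalerA divff ?scale1r//.
Qed.

(** [sobq] at n is a combination of p_n, p_(n-1) and p_(n-2), each orthogonal to every polynomial of
    degree less than n-2. *)
Lemma sobq_orth n (q : {poly R}) :
  (size q <= n.-2)%N -> L (sobq p a b n * q) = 0.
Proof.
case: n => [|[|n]] sq.
- by move: sq; rewrite size_poly_leq0 => /eqP ->; rewrite mulr0 linear0.
- by move: sq; rewrite size_poly_leq0 => /eqP ->; rewrite mulr0 linear0.
rewrite /sobq !mulrDl -!scalerAl !linearD !linearZ /=.
by rewrite !porth ?scaler0 ?addr0//; move: sq => /=; lia.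
Qed.

End sobolev_polynomials.

(** * The gradient inner product and its kernel *)

Section sobolev_orthogonality.
Variables (R : realType) (L1 L2 : {linear {poly R} -> R^o}).
Variables (p1 p2 : nat -> {poly R}) (a1 b1 a2 b2 : nat -> R).
Hypotheses (p1monic : forall m, p1 m \is monic)
           (p2monic : forall m, p2 m \is monic).
Hypotheses (sizep1 : forall m, size (p1 m) = m.+1)
           (sizep2 : forall m, size (p2 m) = m.+1).
Hypotheses
  (p1orth : forall m (q : {poly R}), (size q <= m)%N -> L1 (p1 m * q) = 0)
  (p2orth : forall m (q : {poly R}), (size q <= m)%N -> L2 (p2 m * q) = 0).
Hypotheses (L1_gt0 : forall p : {poly R}, p != 0 -> 0 < L1 (p ^+ 2))
           (L2_gt0 : forall p : {poly R}, p != 0 -> 0 < L2 (p ^+ 2)).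
Hypotheses (coh1 : self_coherent_coeffs p1 a1 b1)
           (coh2 : self_coherent_coeffs p2 a2 b2).
Implicit Types f g P : {poly {poly R}}.

(** The gradient inner product without its normalising constant, a nonzero factor that does not
    affect orthogonality. *)
Definition sobolev_ip f g : R := prodf L1 L2 (dX f * dX g + dY f * dY g).

Definition sobolev_orth m f : Prop := forall P, Pi2 m P -> sobolev_ip f P = 0.

Lemma sobolev_orthD m f g :
  sobolev_orth m f -> sobolev_orth m g -> sobolev_orth m (f + g).
Proof.
move=> hf hg P hP; rewrite /sobolev_ip dXD dYD !mulrDl addrACA prodfD.
by rewrite [LHS](congr2 +%R (hf P hP) (hg P hP)) addr0.
Qed.

Lemma sobolev_orth_cstM m c f : sobolev_orth m f -> sobolev_orth m (cst2 c * f).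
Proof.
move=> hf P hP; rewrite /sobolev_ip dX_cstM dY_cstM -!mulrA -mulrDr prodf_cstM.
by rewrite [X in c * X](hf P hP) mulr0.
Qed.

Lemma sobolev_orth0 f : sobolev_orth 0 f.
Proof.
move=> P /Pi2_0_cst[c ->]; rewrite /sobolev_ip dX_cst2 dY_cst2 !mulr0 addr0.
by rewrite /prodf map_poly0 linear0.
Qed.

Lemma sobolev_orth_sum m (I : Type) (s : seq I) (F : I -> {poly {poly R}}) :
  (forall i, sobolev_orth m (F i)) -> sobolev_orth m (\sum_(i <- s) F i).
Proof.
move=> hF; apply: (big_ind (sobolev_orth m)) => //; last exact: sobolev_orthD.
move=> P _; rewrite /sobolev_ip /dX /dY deriv0 map_poly0 !mul0r addr0.
by rewrite /prodf map_poly0 linear0.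
Qed.

Lemma sobolev_orthN m f : sobolev_orth m f -> sobolev_orth m (- f).
Proof.
by rewrite -[- f]mulN1r -!polyCN; exact: sobolev_orth_cstM.
Qed.

Lemma sobolev_orthW m k f : (k <= m)%N -> sobolev_orth m f -> sobolev_orth k f.
Proof. by move=> km hf P hP; apply: hf; exact: Pi2W hP. Qed.

(** Testing [f] against itself makes the sum of the functional at the squares of both partial
    derivatives zero; by positivity both derivatives vanish. *)
Lemma sobolev_orth_cst m f : Pi2 m f -> sobolev_orth m f ->
  exists c, f = cst2 c.
Proof.
have sqr_ge0 g : 0 <= prodf L1 L2 (g ^+ 2).
  have [->|g0] := eqVneq g 0; first
    by rewrite expr0n /= /prodf map_poly0 linear0.
  exact/ltW/(prodf_sqr_gt0 p1monic).
have sqr_eq0 g : prodf L1 L2 (g ^+ 2) = 0 -> g = 0.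
  move=> h; apply/eqP/negPn/negP => g0.
  by have := prodf_sqr_gt0 p1monic sizep1 p1orth L1_gt0 L2_gt0 g0;
    rewrite h ltxx.
move=> hf /(_ f hf); rewrite /sobolev_ip prodfD -!expr2 => /eqP.
rewrite paddr_eq0// => /andP[/eqP fx /eqP fy].
by apply: grad0_cst; exact: sqr_eq0.
Qed.

(** * Leading terms and Sobolev orthogonality of the products Q *)

Local Notation q1 := (sobq p1 a1 b1).
Local Notation q2 := (sobq p2 a2 b2).
Local Notation Q i k := ((q1 i)^:P * (q2 k)%:P).

(** The coefficients of [Q i k] live in the box of exponents at most (i, k), whose only point of
    total degree at least i + k is its corner. *)
Lemma sobQ_lead i k : (0 < i + k)%N ->
  Pi2 (i + k).-1 (Q i k - 'X ^+ i * 'Y ^+ k).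
Proof.
move=> ik0 i' k' h; rewrite 2!coefB coef_XY coefMC coef_map /= coefCM.
have [ii'|ii'|ii'] := ltngtP i' i.
- rewrite subr0 [(q2 k)`_k']nth_default ?mulr0// size_sobq//; lia.
- by rewrite nth_default ?mul0r ?subr0// size_sobq.
rewrite ii'; have [kk'|kk'|->] := ltngtP k' k; first lia.
  by rewrite [(q2 k)`_k']nth_default ?mulr0 ?subr0// size_sobq.
by rewrite !sobq_lead// mulr1 subrr.
Qed.

Let Qx i k P : prodf L1 L2 (dX (Q i k) * dX P) =
  if i is i'.+1 then i%:R * prodf L1 L2 ((p1 i')^:P * (q2 k)%:P * dX P) else 0.
Proof.
rewrite dX_prod; case: i => [|i].
  by rewrite /sobq -polyC1 derivC map_poly0 !mul0r /prodf map_poly0 linear0.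
rewrite deriv_sobqS// -prodf_cstM -mul_polyC rmorphM /= map_polyC /=.
by rewrite /cst2 !mulrA.
Qed.

Let Qy i k P : prodf L1 L2 (dY (Q i k) * dY P) =
  if k is k'.+1 then k%:R * prodf L1 L2 ((q1 i)^:P * (p2 k')%:P * dY P) else 0.
Proof.
rewrite dY_prod; case: k => [|k].
  by rewrite /sobq -polyC1 derivC mulr0 mul0r /prodf map_poly0 linear0.
rewrite deriv_sobqS// -prodf_cstM -mul_polyC rmorphM /= /cst2.
by rewrite mulrCA !mulrA.
Qed.

(** For i, k > 0 the x-derivative is a multiple of p_(i-1)(x) q_k(y), with orthogonality bounds i-1
    and k-2 summing to at least i + k - 3, while [dX P] has degree at most i + k - 4. The
    y-derivative is symmetric. *)
Lemma sobQ_orth i k : sobolev_orth (i + k - 3) (Q i k).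
Proof.
(* Here the truncated subtraction gives 0, and constants have zero gradient. *)
have [ik|ik] := leqP (i + k) 3.
  by rewrite (eqP ik); exact: sobolev_orth0.
have -> : (i + k - 3)%N = (i + k - 4).+1 by lia.
move=> P hP; rewrite /sobolev_ip prodfD Qx Qy.
(* When one index is 0 its factor is 1 and one partial derivative vanishes; the bound 0 is then used
   for the constant factor. *)
case: i k ik hP => [|i] [|k] ik hP.
- by rewrite addr0.
- rewrite add0r (prodf_orth (t := 0) (s := k) (m := k - 3)) ?mulr0//.
  + by move=> u; rewrite size_poly_leq0 => /eqP ->; rewrite mulr0 linear0.
  + exact: p2orth.
  + by apply: Pi2_dY; move: hP; congr Pi2; lia.
  + lia.
- rewrite addr0 (prodf_orth (t := i) (s := 0) (m := i - 3)) ?mulr0//.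
  + exact: p1orth.
  + by move=> u; rewrite size_poly_leq0 => /eqP ->; rewrite mulr0 linear0.
  + by apply: Pi2_dX; move: hP; congr Pi2; lia.
  + lia.
rewrite (prodf_orth (t := i) (s := k.+1.-2) (m := i.+1 + k.+1 - 4)).
- rewrite (prodf_orth (t := i.+1.-2) (s := k) (m := i.+1 + k.+1 - 4)).
  + by rewrite !mulr0 addr0.
  + by move=> u; exact: sobq_orth.
  + exact: p2orth.
  + exact: Pi2_dY.
  + lia.
- exact: p1orth.
- by move=> u; exact: sobq_orth.
- exact: Pi2_dX.
- lia.
Qed.

(** Only the x-derivative (n+1) p_n(x) survives, and it is orthogonal to [dX P], of degree at most
    n-1 when n > 0. *)
Lemma sobQ_orth_x n : sobolev_orth n (Q n.+1 0).
Proof.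
case: n => [|n]; first exact: sobolev_orth0.
move=> P hP; rewrite /sobolev_ip prodfD Qx Qy addr0.
rewrite (prodf_orth (t := n.+1) (s := 0) (m := n)) ?mulr0 ?addn0//.
- exact: p1orth.
- by move=> u; rewrite size_poly_leq0 => /eqP ->; rewrite mulr0 linear0.
- exact: Pi2_dX.
Qed.

Lemma sobQ_orth_y n : sobolev_orth n (Q 0 n.+1).
Proof.
case: n => [|n]; first exact: sobolev_orth0.
move=> P hP; rewrite /sobolev_ip prodfD Qx Qy add0r.
rewrite (prodf_orth (t := 0) (s := n.+1) (m := n)) ?mulr0 ?add0n//.
- by move=> u; rewrite size_poly_leq0 => /eqP ->; rewrite mulr0 linear0.
- exact: p2orth.
- exact: Pi2_dY.
Qed.

(** * Expansion of Q in the Sobolev orthogonal polynomials S *)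

Variable S : nat -> nat -> {poly {poly R}}.
Hypothesis S_lead : forall n k, (1 <= n)%N -> (k <= n)%N ->
  Pi2 n.-1 (S n k - 'X ^+ (n - k) * 'Y ^+ k).
Hypothesis S_orth : forall n k, (1 <= n)%N -> (k <= n)%N ->
  sobolev_orth n.-1 (S n k).

Lemma sobQ_sub_S n k : (k <= n.+1)%N -> Pi2 n (Q (n.+1 - k) k - S n.+1 k).
Proof.
move=> kn; have -> : Q (n.+1 - k) k - S n.+1 k =
    (Q (n.+1 - k) k - 'X ^+ (n.+1 - k) * 'Y ^+ k)
    - (S n.+1 k - 'X ^+ (n.+1 - k) * 'Y ^+ k).
  by rewrite opprB addrA subrK.
apply: Pi2D; last by apply/Pi2N/(@S_lead n.+1).
by have := @sobQ_lead (n.+1 - k) k; rewrite subnK//; exact.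
Qed.

Lemma sobolev_orth_expansion m f : Pi2 m.+1 f -> sobolev_orth m.-1 f ->
  exists A B : nat -> R,
    doteq f (\sum_(i < m.+2) cst2 (A i) * S m.+1 i
             + \sum_(i < m.+1) cst2 (B i) * S m i).
Proof.
move=> hf fo.
pose A i := f`_(m.+1 - i)`_i.
pose f1 := f - \sum_(i < m.+2) cst2 (A i) * S m.+1 i.
have hf1 : Pi2 m f1 by apply: Pi2_reduce hf _ => i im; exact: (@S_lead m.+1).
have fo1 : sobolev_orth m.-1 f1.
  apply: sobolev_orthD => //; apply/sobolev_orthN/sobolev_orth_sum => i.
  apply/sobolev_orth_cstM/(sobolev_orthW (leq_pred m))/(@S_orth m.+1) => //.
  by rewrite -ltnS.
(* For m = 0 the remainder [f1] is already constant, so the second family of coefficients is taken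
   to be zero. *)
exists A; case: m => [|m] in f hf fo A f1 hf1 fo1 *.
  exists (fun=> 0); have [c fc] := Pi2_0_cst hf1; exists c.
  by rewrite [X in _ - (_ + X)]big1 ?addr0// => i _;
    rewrite /cst2 !polyC0 mul0r.
pose B i := f1`_(m.+1 - i)`_i.
pose f2 := f1 - \sum_(i < m.+2) cst2 (B i) * S m.+1 i.
(* Two reductions bring the degree down to that of the test polynomials, so [f2] is orthogonal to
   itself. *)
exists B; have [||c f2c] := @sobolev_orth_cst m f2.
- by apply: Pi2_reduce hf1 _ => i im; exact: (@S_lead m.+1).
- apply: sobolev_orthD => //; apply/sobolev_orthN/sobolev_orth_sum => i.
  by apply/sobolev_orth_cstM/(@S_orth m.+1) => //; rewrite -ltnS.
by exists c; rewrite -f2c /f2 /f1 opprD addrA.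
Qed.

(** The leading monomials cancel in [Q n.+1 0 - S n.+1 0], which then has degree at most n and is
    orthogonal to all of that degree. *)
Lemma sobQ_x_S n : doteq (S n.+1 0) (sobQ q1 q2 n.+1 0).
Proof.
have [||c h] := @sobolev_orth_cst n (Q n.+1 0 - S n.+1 0).
- by have := @sobQ_sub_S n 0; rewrite subn0; exact.
- apply: sobolev_orthD; first exact: sobQ_orth_x.
  exact/sobolev_orthN/(@S_orth n.+1).
by exists (- c); rewrite /sobQ subn0 -opprB h /cst2 !polyCN.
Qed.

Lemma sobQ_y_S n : doteq (S n.+1 n.+1) (sobQ q1 q2 n.+1 n.+1).
Proof.
have [||c h] := @sobolev_orth_cst n (Q 0 n.+1 - S n.+1 n.+1).
- by have := @sobQ_sub_S n n.+1; rewrite subnn; exact.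
- apply: sobolev_orthD; first exact: sobQ_orth_y.
  exact/sobolev_orthN/(@S_orth n.+1).
by exists (- c); rewrite /sobQ subnn -opprB h /cst2 !polyCN.
Qed.

(** The coefficients are paired so that one choice over [k] yields both matrices; the clause on the
    end indices later gives their zero rows. *)
Lemma sobQ_expansion n k : (k <= n.+1)%N ->
  exists AB : (nat -> R) * (nat -> R),
    ((k == 0%N) || (k == n.+1) -> AB = (fun=> 0, fun=> 0)) /\
    doteq (sobQ q1 q2 n.+1 k)
      (S n.+1 k + \sum_(i < n.+1) cst2 (AB.1 i) * S n i
                + \sum_(i < n) cst2 (AB.2 i) * S n.-1 i).
Proof.
move=> kn.
set goal := (exists AB, _).
have ends : doteq (S n.+1 k) (sobQ q1 q2 n.+1 k) -> goal.
  move=> [c h]; exists (fun=> 0, fun=> 0); split => //; exists (- c).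
  rewrite !big1 ?addr0 => [|i _|i _]; rewrite /= ?/cst2 ?polyC0 ?mul0r//.
  by rewrite -opprB h /cst2 !polyCN.
have [k0|k0] := eqVneq k 0%N.
  by apply: ends; rewrite k0; exact: sobQ_x_S.
have [kn1|kn1] := eqVneq k n.+1.
  by apply: ends; rewrite kn1; exact: sobQ_y_S.
(* In degree 1 both indices are end indices, already treated. *)
case: n => [|n] in kn kn1 @goal ends *; first lia.
have [||A [B [c h]]] := @sobolev_orth_expansion n (Q (n.+2 - k) k - S n.+2 k).
- exact: sobQ_sub_S.
- apply: sobolev_orthD.
    by have := @sobQ_orth (n.+2 - k) k; congr (sobolev_orth _ _); lia.
  apply/sobolev_orthN/sobolev_orthW/(@S_orth n.+2) => //=; lia.
exists (A, B); split; first by rewrite (negbTE k0) (negbTE kn1).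
by exists c; rewrite -h !opprD !addrA.
Qed.

End sobolev_orthogonality.

(** * From integrals to functionals, and assembly of the matrices *)

Theorem theorem2p5 (R : realType) (l1 r1 l2 r2 : \bar R) (w1 w2 : R -> R)
    (p1 p2 : nat -> {poly R}) (a1 b1 a2 b2 : nat -> R)
    (Sb : nat -> nat -> {poly {poly R}}) (n : nat)
    (hw1 : weight l1 r1 w1) (hw2 : weight l2 r2 w2)
    (hp1 : monic_ops l1 r1 w1 p1) (hp2 : monic_ops l2 r2 w2 p2)
    (hc1 : self_coherent_coeffs p1 a1 b1)
    (hc2 : self_coherent_coeffs p2 a2 b2)
    (hS : sobolev_monic_ops l1 r1 l2 r2 w1 w2 Sb)
    (hn : (1 <= n)%N) :
  let Q := sobQ (sobq p1 a1 b1) (sobq p2 a2 b2) in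
  (exists (A : 'M[R]_(n.+1, n)) (B : 'M[R]_(n.+1, n.-1)),
    [/\ forall k : 'I_n.+1,
          doteq (Q n k)
            (Sb n k + \sum_(i < n) cst2 (A k i) * Sb n.-1 i
                   + \sum_(i < n.-1) cst2 (B k i) * Sb n.-2 i),
        doteqv (\col_(k < n.+1) Q n k)
          (\col_(k < n.+1) Sb n k
           + map_mx (@cst2 R) A *m \col_(i < n) Sb n.-1 i
           + map_mx (@cst2 R) B *m \col_(i < n.-1) Sb n.-2 i),
        row ord0 A = 0 /\ row ord_max A = 0
      & row ord0 B = 0 /\ row ord_max B = 0]) /\
  (doteq (Sb n 0%N) (Q n 0%N) /\ doteq (Sb n n) (Q n n)).
Proof.
move=> Q.
pose L1 : {linear {poly R} -> R^o} := HB.pack (wint l1 r1 w1 : {poly R} -> R^o)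
  (GRing.isLinear.Build _ _ _ _ _ (wint_is_linear hw1)).
pose L2 : {linear {poly R} -> R^o} := HB.pack (wint l2 r2 w2 : {poly R} -> R^o)
  (GRing.isLinear.Build _ _ _ _ _ (wint_is_linear hw2)).
have L1_gt0 (q : {poly R}) : q != 0 -> 0 < L1 (q ^+ 2).
  by case: (hw1) => _ _; exact.
have L2_gt0 (q : {poly R}) : q != 0 -> 0 < L2 (q ^+ 2).
  by case: (hw2) => _ _; exact.
have m1 m : p1 m \is monic by case: (hp1 m).
have m2 m : p2 m \is monic by case: (hp2 m).
have s1 m : size (p1 m) = m.+1 by case: (hp1 m).
have s2 m : size (p2 m) = m.+1 by case: (hp2 m).
have o1 m (q : {poly R}) : (size q <= m)%N -> L1 (p1 m * q) = 0.
  by case: (hp1 m) => _ _; exact.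
have o2 m (q : {poly R}) : (size q <= m)%N -> L2 (p2 m * q) = 0.
  by case: (hp2 m) => _ _; exact.
have ipE f g : grad_ip l1 r1 l2 r2 w1 w2 f g =
    (prodf L1 L2 1)^-1 * sobolev_ip L1 L2 f g.
  by rewrite /grad_ip !wint2_iterated.
(* The total mass of W is positive, as the functional at the square of 1, so the normalising
   constant can be cancelled. *)
have one_neq0 : prodf L1 L2 1 != 0.
  have := @prodf_sqr_gt0 R L1 L2 p1 m1 s1 o1 L1_gt0 L2_gt0 1 (oner_neq0 _).
  by rewrite expr1n => /gt_eqF ->.
have S_lead m k : (1 <= m)%N -> (k <= m)%N ->
    Pi2 m.-1 (Sb m k - 'X ^+ (m - k) * 'Y ^+ k).
  by move=> m0 km; case: (hS.2 m k m0 km).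
have S_orth m k : (1 <= m)%N -> (k <= m)%N ->
    sobolev_orth L1 L2 m.-1 (Sb m k).
  move=> m0 km P hP; have [_ /(_ P hP)] := hS.2 m k m0 km.
  rewrite ipE => ip0; apply: (mulfI (invr_neq0 one_neq0)).
  by rewrite mulr0.
case: n hn => // n' _ in Q *; split; last first.
  split.
    exact: (sobQ_x_S m1 m2 s1 s2 o1 L1_gt0 L2_gt0 hc1 hc2 S_lead S_orth).
  exact: (sobQ_y_S m1 m2 s1 s2 o1 o2 L1_gt0 L2_gt0 hc1 hc2 S_lead S_orth).
(* Choosing coefficients for every [k] at once gives the rows of both matrices. *)
have /choice[AB ABP] (k : 'I_n'.+2) :=
  sobQ_expansion m1 m2 s1 s2 o1 o2 L1_gt0 L2_gt0 hc1 hc2 S_lead S_orth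
    (ltn_ord k : (k <= n'.+1)%N).
have QE (k : 'I_n'.+2) : doteq (Q n'.+1 k)
    (Sb n'.+1 k + \sum_(i < n'.+1) cst2 ((AB k).1 i) * Sb n' i
                + \sum_(i < n') cst2 ((AB k).2 i) * Sb n'.-1 i).
  by have [_] := ABP k.
have AB0 : AB ord0 = (fun=> 0, fun=> 0) by apply: (ABP ord0).1.
have ABm : AB ord_max = (fun=> 0, fun=> 0).
  by apply: (ABP ord_max).1; rewrite /= eqxx.
exists (\matrix_(k, i) (AB k).1 i), (\matrix_(k, i) (AB k).2 i); split.
- move=> k; under eq_bigr do rewrite mxE.
  by under [X in _ + X]eq_bigr do rewrite mxE.
- move=> k; rewrite !mxE.
  under eq_bigr do rewrite !mxE.
  by under [X in _ + X]eq_bigr do rewrite !mxE.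
- by split; apply/rowP => i; rewrite !mxE ?AB0 ?ABm.
- by split; apply/rowP => i; rewrite !mxE ?AB0 ?ABm.
Qed.
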